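(* Let $\lambda_1,\lambda_2,\lambda_3$ be positive integers with $\lambda_1=\max\{\lambda_1,\lambda_2,\lambda_3\}$ and $\lambda_1<\lambda_2+\lambda_3$. Let $[e_\mu]X$ denote the coefficient of $e_\mu$ in the expansion of the symmetric function $X$ in the elementary basis. Then: 1) if $\lambda_2+\lambda_3\ne\lambda_1+1$, then $[e_{(\lambda_2+\lambda_3+1,\ \lambda_1+2)}]X_{S(3;\lambda_1,\lambda_2,\lambda_3)}=-2(\lambda_1+\lambda_2+\lambda_3+3)$; 2) if $\lambda_2+\lambda_3=\lambda_1+1$, then $[e_{(\lambda_2+\lambda_3+1,\ \lambda_1+2)}]X_{S(3;\lambda_1,\lambda_2,\lambda_3)}=-(\lambda_1+\lambda_2+\lambda_3+3)$.
   Context: All graphs are finite and simple. $P_k$ denotes the path with $k$ vertices; for $k=1$ the single vertex counts as its leaf. For positive integers $\lambda_1,\lambda_2,\lambda_3$, the sun graph $S(3;\lambda_1,\lambda_2,\lambda_3)$ is obtained from the triangle with vertices $v_1,v_2,v_3$ and three disjoint paths $P_{\lambda_1},P_{\lambda_2},P_{\lambda_3}$ (disjoint from the triangle) by connecting $v_i$ by an edge to a leaf of $P_{\lambda_i}$ for $i=1,2,3$. The chromatic symmetric function of a graph $G$ with vertices $v_1,\ldots,v_d$ is $X_G=\sum_{\kappa} x_{\kappa(v_1)}\cdots x_{\kappa(v_d)}$, the sum over all proper colourings $\kappa:V(G)\to\mathbb{N}$, with $x_1,x_2,\ldots$ commuting variables. The elementary basis of the algebra of symmetric functions (over $\mathbb{Q}$)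 consists of $e_\lambda=e_{\lambda_1}e_{\lambda_2}\cdots$, $\lambda$ an integer partition, where $e_i=\sum_{j_1<\cdots<j_i}x_{j_1}\cdots x_{j_i}$. *)

(* Defs.v *)
From HB Require Import structures.
From mathcomp Require Import all_boot all_order all_algebra.
From mathcomp Require Import finmap multiset.
From mathcomp Require Import boolp classical_sets functions cardinality fsbigop.

Set Implicit Arguments.
Unset Strict Implicit.
Unset Printing Implicit Defensive.

Import Order.TTheory GRing.Theory Num.Theory.

Local Open Scope classical_set_scope.
Local Open Scope ring_scope.

Record sgraph := SGraph {
  vertex :> finType;
  edge : rel vertex;
  edge_sym : symmetric edge;
  edge_irr : irreflexive edge }.

(* The vertex [inl i] is the triangle vertex v_(i+1), and [inr (Tagged _ k)]
   with tag i is the k-th vertex (from 0) of the path with [l i] vertices, the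
   vertex 0 being the leaf that is joined to v_(i+1). *)
Definition sun_edge (l : 'I_3 -> nat) : rel ('I_3 + {i : 'I_3 & 'I_(l i)}) :=
  fun u w => match u, w with
  | inl i, inl j => i != j
  | inl i, inr q => (tag q == i) && (tagged q == 0 :> nat)%N
  | inr p, inl j => (tag p == j) && (tagged p == 0 :> nat)%N
  | inr p, inr q => (tag p == tag q) &&
      (((tagged p).+1 == tagged q :> nat) || ((tagged q).+1 == tagged p :> nat))
  end.

Lemma sun_edge_sym l : symmetric (@sun_edge l).
Proof. by case=> [i|p] [j|q] //=; rewrite eq_sym // orbC. Qed.

Lemma sun_edge_irr l : irreflexive (@sun_edge l).
Proof.
by case=> [i|p] /=; rewrite eqxx //= orbb; apply/negbTE; rewrite neq_ltn ltnSn orbT.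
Qed.

Definition sun (l1 l2 l3 : nat) : sgraph :=
  SGraph (@sun_edge_sym (fun i => nth 0%N [:: l1; l2; l3] i))
         (@sun_edge_irr (fun i => nth 0%N [:: l1; l2; l3] i)).

(* Formal power series over the rationals in countably many commuting variables
   indexed by nat.  A monomial is the finite multiset of the indices of its
   variables, so that the product of monomials is the sum of multisets; a power
   series maps each monomial to its coefficient.  All the sums [\sum_(_ \in _)]
   below have finite support, for each fixed monomial [m]. *)
Definition powser : Type := {mset nat}%mset -> rat.

Definition psone : powser := fun m => (m == mset0)%:R.

Definition psmul (f g : powser) : powser := fun m =>
  \sum_(p \in [set p : {mset nat}%mset * {mset nat}%mset | (p.1 `+` p.2)%mset = m])
    f p.1 * g p.2.

Definition proper (G : sgraph) (k : {ffun G -> nat}) : Prop :=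
  forall u v : G, edge u v -> k u != k v.

(* [seq_mset (codom k)] is the monomial \prod_v x_(k v). *)
Definition chromatic_sf (G : sgraph) : powser := fun m =>
  \sum_(k \in [set k : {ffun G -> nat} | proper k]) ((m == seq_mset (codom k))%:R : rat).

(* [seq_mset A] is the squarefree monomial \prod_(j in A) x_j. *)
Definition elementary (i : nat) : powser := fun m =>
  \sum_(A \in [set A : {fset nat} | #|` A| = i]) 
    ((m == seq_mset (enum_fset A))%:R : rat).

Definition is_partition (la : seq nat) : bool :=
  sorted geq la && all (fun i => 0 < i)%N la.

Definition elementary_prod (la : seq nat) : powser :=
  foldr (fun i => psmul (elementary i)) psone la.

Definition e_expansion (X : powser) (c : {fsfun seq nat -> rat with 0}) : Prop :=
  (forall la, la \in finsupp c -> is_partition la) /\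
  forall m, X m = \sum_(la <- finsupp c) c la * elementary_prod la m.

(* The coefficient of e_mu in X.  The expansion of a symmetric function X is
   unique, and the value is 0 if X has no expansion. *)
Definition e_coef (mu : seq nat) (X : powser) : rat :=
  xget [fsfun] [set c | e_expansion X c] mu.

(* Main.v *)
Require Import Defs.
From mathcomp Require Import all_boot all_order all_algebra.
From mathcomp Require Import finmap multiset.
From mathcomp Require Import boolp classical_sets functions cardinality fsbigop.
From mathcomp Require Import mpoly ring zify.

Set Implicit Arguments.
Unset Strict Implicit.
Unset Printing Implicit Defensive.

Import Order.TTheory GRing.Theory Num.Theory.

Local Open Scope ring_scope.

(** Write n = l1 + l2 + l3 + 3, a = l2 + l3 + 1 and b = l1 + 2, so that n = a + b
    and b <= a.

    Colour the triangle first.  An arm hung on a vertex of colour c contributes a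
    polynomial in x_c whose coefficients are polynomials in the power sums
    ([walks_arm_poly]).  Inclusion-exclusion over coincidences of the three triangle
    colours ([sum_triangle]) then expresses X as a universal polynomial in the
    power sums p_1, ..., p_n ([sun_colour_sum_edges]), and Newton's identities make
    it a universal polynomial Q in e_1, ..., e_n ([sun_epoly_mesym]).  Thus X has an
    expansion in the elementary basis ([e_expansion_exists]), and since the
    elementary polynomials in n variables are algebraically independent, any
    expansion is given by Q ([e_expansion_unique]).

    To read off the coefficient of e_a e_b in Q, send e_a and e_b to two
    independent variables (to their sum if a = b) and all other e_i with i > 0 to 0.
    As e_1, ..., e_(b-1) become 0, so do p_1, ..., p_(b-1).  All arms have at most
    b - 2 vertices, so everything in the inclusion-exclusion dies except the term
    where the three triangle colours agree, which is 2 (-1)^(n-1) p_n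
    ([sun_of_powsum_top]).  By Newton, the coefficient of e_a e_b in (-1)^(n-1) p_n
    is -(a + b) = -n after the specialisation ([coef_powsum_two_part]).  This gives
    -2n if a <> b; if a = b the specialisation counts e_a e_a twice, which leaves
    -n. *)

(** * Newton's identities *)

Section Newton.
Variable R : comNzRingType.
Implicit Types e p : nat -> R.

(** Newton's identity solved for its last power sum.  The indices are shifted:
    entry [k] of the sequence [p] stands for the power sum p_(k+1), because p_0
    depends on the number of variables and is not a polynomial in the e_i. *)
Definition powsum_step e p k : R :=
  (-1) ^+ k * (e k.+1 *+ k.+1 - \sum_(i < k) (-1) ^+ i * e (k - i)%N * p i).

(** The power sum p_(k+1) as a universal polynomial in the values [e i].  One
    step of the iteration only reads the entries below [k], so after [k + 1]
    steps entry [k] no longer depends on the initial sequence. *)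
Definition powsum e k : R := iter k.+1 (powsum_step e) (fun=> 0) k.
Arguments powsum : simpl never.

Lemma eq_powsum_step e e' p p' k :
    (forall i, (0 < i <= k.+1)%N -> e i = e' i) ->
    (forall i, (i < k)%N -> p i = p' i) ->
  powsum_step e p k = powsum_step e' p' k.
Proof.
move=> ee pp; rewrite /powsum_step ee ?leqnn //; congr (_ * (_ - _)).
apply: eq_bigr => i _; rewrite ee ?pp //.
by rewrite subn_gt0 ltn_ord; lia.
Qed.

Lemma powsumE e k : powsum e k = powsum_step e (powsum e) k.
Proof.
have stable p i m m' : (i < m)%N -> (i < m')%N ->
    iter m (powsum_step e) p i = iter m' (powsum_step e) p i.
  elim/ltn_ind: i m m' => i IHi [|m] [|m'] //= im im'.
  by apply: eq_powsum_step => // j ji; apply: IHi; lia.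
rewrite {1}/powsum iterS; apply: eq_powsum_step => // i ik; exact: stable.
Qed.

Lemma powsum_unique e p n : (forall k, (k < n)%N -> p k = powsum_step e p k) ->
  forall k, (k < n)%N -> p k = powsum e k.
Proof.
move=> pE; elim/ltn_ind=> k IHk kn; rewrite pE // powsumE.
by apply: eq_powsum_step => // i ik; apply: IHk => //; apply: ltn_trans kn.
Qed.

Lemma eq_powsum e e' n : (forall i, (0 < i <= n)%N -> e i = e' i) ->
  forall k, (k < n)%N -> powsum e k = powsum e' k.
Proof.
move=> ee; apply: powsum_unique => k kn; rewrite powsumE.
by apply: eq_powsum_step => // i ik; apply: ee; lia.
Qed.

End Newton.

Lemma rmorph_powsum (R S : comNzRingType) (f : {rmorphism R -> S}) e k :
  f (powsum e k) = powsum (f \o e) k.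
Proof.
apply: (@powsum_unique _ (f \o e) (f \o powsum e) k.+1) => // {}k _ /=.
rewrite powsumE /powsum_step rmorphM rmorphXn rmorphN1 rmorphB rmorphMn.
rewrite rmorph_sum; congr (_ * (_ - _)). apply: eq_bigr => i _.
by rewrite 2!rmorphM rmorphXn rmorphN1.
Qed.

Section ElementarySums.
Variables (R : comNzRingType) (I : finType) (x : I -> R).

Definition esum k : R := \sum_(A : {set I} | #|A| == k) \prod_(i in A) x i.

(** The monomial sums indexed by the hooks (j + 1, 1^k), which let Newton's
    identity telescope: e_(k+1) p_(j+1) = hook j (k + 1) + hook (j + 1) k. *)
Let hook j k : R :=
  \sum_i \sum_(A : {set I} | (#|A| == k) && (i \notin A))
    x i ^+ j.+1 * \prod_(c in A) x c.

Let sum_sets_with i k :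
  \sum_(A : {set I} | (#|A| == k.+1) && (i \in A)) \prod_(c in A) x c =
  \sum_(A : {set I} | (#|A| == k) && (i \notin A)) x i * \prod_(c in A) x c.
Proof.
rewrite (reindex_onto (fun A => i |: A) (fun A => A :\ i)) /=; last first.
  by move=> A /andP[_ iA]; rewrite finset.setD1K.
apply: eq_big => A.
  rewrite setU11 andbT cardsU1; case: (boolP (i \in A)) => iA /=.
    rewrite andbF [X in _ && X](_ : _ = false) ?andbF //.
    by apply/negbTE/eqP=> /setP/(_ i); rewrite !inE eqxx iA.
  by rewrite add1n eqSS finset.setU1K ?eqxx // !andbT.
move=> /andP[_ /eqP AE].
by rewrite big_setU1 // -AE !inE eqxx.
Qed.

Lemma esum_powsum k (p := fun k => \sum_i x i ^+ k.+1) :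
  p k = powsum_step esum p k.
Proof.
have prod_hook j m : esum m.+1 * p j = hook j m.+1 + hook j.+1 m.
  rewrite /hook -big_split /= mulrC mulr_suml.
  apply: eq_bigr => i _; rewrite mulr_sumr (bigID (fun A : {set I} => i \in A)).
  rewrite addrC /=; congr (_ + _).
  under [RHS]eq_bigr do rewrite exprSr -mulrA.
  by rewrite -!mulr_sumr sum_sets_with mulr_sumr.
have hook0l : hook 0 k = esum k.+1 *+ k.+1.
  rewrite /esum -sumrMnl.
  under [RHS]eq_bigr => A /eqP cA do rewrite -cA -sumr_const.
  rewrite (exchange_big_dep xpredT) //=; apply: eq_bigr => i _.
  by rewrite sum_sets_with; apply: eq_bigr => A _; rewrite expr1.
have hook0r : hook k 0 = p k.
  apply: eq_bigr => i _; rewrite (big_pred1 finset.set0) ?big_set0 ?mulr1 // => A.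
  by rewrite cards_eq0 andb_idr // => /eqP->; rewrite inE.
rewrite /powsum_step -hook0l.
pose u i := (-1) ^+ i * hook i (k - i)%N.
rewrite (_ : \sum_(i < k) _ = u 0 - u k).
  rewrite /u expr0 mul1r subn0 subnn hook0r opprB addrCA subrr addr0.
  by rewrite mulrA -expr2 sqrr_sign mul1r.
rewrite -[RHS]opprB -(telescope_sumr u (leq0n k)) big_mkord -sumrN.
apply: eq_bigr => i _; rewrite opprB -mulrA.
have -> : (k - i = (k - i.+1).+1)%N by have := ltn_ord i; lia.
rewrite prod_hook /u exprS.
have -> : (k - i = (k - i.+1).+1)%N by have := ltn_ord i; lia.
ring.
Qed.

End ElementarySums.

(** * The sun graph in terms of power sums *)

Section Universal.
Variable R : comNzRingType.
Implicit Types (p : nat -> R) (q : {poly R}).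

(** The linear functional sending 'X^k to p_(k+1).  When the power sums are those
    of a family [x], it is q |-> sum_i x_i q(x_i) (lemma [pairing_horner]). *)
Definition pairing p q : R := \sum_(i < size q) q`_i * p i.

(** [arm_poly p l], evaluated at a variable x_c, is the generating function of the
    proper colourings of a path with [l] vertices hung on a vertex of colour c
    (lemma [walks_arm_poly]): the first vertex of the path takes any colour, minus the
    colourings where it has colour c. *)
Fixpoint arm_poly p l : {poly R} :=
  if l is l'.+1 then (pairing p (arm_poly p l'))%:P - 'X * arm_poly p l' else 1.

(** The chromatic symmetric function of the sun graph in terms of power sums: the
    inclusion-exclusion of [sum_triangle] over the coincidences between the
    colours of the three triangle vertices. *)
Definition sun_of_powsum p l1 l2 l3 : R :=
  let s l := pairing p (arm_poly p l) in
  let t l l' := pairing p ('X * (arm_poly p l * arm_poly p l')) in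
  s l1 * s l2 * s l3 - t l1 l2 * s l3 - t l1 l3 * s l2 - t l2 l3 * s l1
  + pairing p ('X^2 * (arm_poly p l1 * arm_poly p l2 * arm_poly p l3)) *+ 2.

Lemma pairing_widen p q n : (size q <= n)%N -> pairing p q = \sum_(i < n) q`_i * p i.
Proof.
move=> qn; rewrite /pairing (big_ord_widen n (fun i => q`_i * p i) qn) big_mkcond.
apply: eq_bigr => i _; case: ltnP => // /leq_sizeP/(_ i (leqnn i))->.
by rewrite mul0r.
Qed.

Lemma eq_pairing p p' q n : (size q <= n)%N ->
  (forall k, (k < n)%N -> p k = p' k) -> pairing p q = pairing p' q.
Proof.
move=> qn pp; apply: eq_bigr => i _.
by rewrite pp ?(leq_trans (ltn_ord i)).
Qed.

Lemma pairing_monom p (c : R) k : pairing p (c *: 'X^k) = c * p k.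
Proof.
rewrite (@pairing_widen _ _ k.+1); last first.
  by apply: leq_trans (size_scale_leq _ _) _; rewrite size_polyXn.
rewrite big_ord_recr big1 /= ?add0r ?coefZ ?coefXn ?eqxx ?mulr1 // => i _.
by rewrite coefZ coefXn (ltn_eqF (ltn_ord i)) mulr0 mul0r.
Qed.

Lemma size_arm_poly p l : (size (arm_poly p l) <= l.+1)%N.
Proof.
elim: l => [|l IHl] /=; first by rewrite size_poly1.
rewrite (leq_trans (size_polyD _ _)) // geq_max size_polyN.
rewrite (leq_trans (size_polyC_leq1 _)) //=.
by rewrite (leq_trans (size_polyMleq _ _)) // size_polyX.
Qed.

Lemma eq_arm_poly p p' l : (forall k, (k < l)%N -> p k = p' k) -> arm_poly p l = arm_poly p' l.
Proof.
elim: l => //= l IHl pp.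
rewrite -IHl ?(@eq_pairing _ p' _ l.+1) ?size_arm_poly //.
by move=> k kl; apply: pp; apply: leq_trans kl _.
Qed.

(** A degree count: every product occurring in [sun_of_powsum] pairs a polynomial
    whose degree, shifted by one, is at most the number of vertices.  This allows
    one polynomial in finitely many e_i to serve for any number of variables. *)
Lemma eq_sun_of_powsum p p' l1 l2 l3 :
    (forall k, (k < l1 + l2 + l3 + 3)%N -> p k = p' k) ->
  sun_of_powsum p l1 l2 l3 = sun_of_powsum p' l1 l2 l3.
Proof.
move=> pp; rewrite /sun_of_powsum.
have arm_pp l : (l < l1 + l2 + l3 + 3)%N -> arm_poly p l = arm_poly p' l.
  by move=> lt_l; apply: eq_arm_poly => k kl; apply: pp; apply: ltn_trans lt_l.
rewrite !arm_pp; try lia.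
have szM (q q' : {poly R}) m m' : (size q <= m.+1)%N -> (size q' <= m'.+1)%N ->
    (size (q * q')%R <= (m + m').+1)%N.
  by move=> qm qm'; apply: leq_trans (size_polyMleq q q') _; lia.
have sz := size_arm_poly p'; have szX : (size ('X : {poly R}) <= 2)%N by rewrite size_polyX.
have szX2 : (size ('X^2 : {poly R}) <= 3)%N by rewrite size_polyXn.
have pairing_pp q m : (size q <= m.+1)%N -> (m < l1 + l2 + l3 + 3)%N ->
    pairing p q = pairing p' q.
  by move=> qm mn; apply: (@eq_pairing _ _ _ m.+1) => // k km; apply: pp; lia.
rewrite (pairing_pp (arm_poly p' l1) l1) ?(pairing_pp (arm_poly p' l2) l2) ?(pairing_pp (arm_poly p' l3) l3) //; try lia.
rewrite (pairing_pp _ _ (szM _ _ 1 _ szX (szM _ _ _ _ (sz l1) (sz l2)))); try lia.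
rewrite (pairing_pp _ _ (szM _ _ 1 _ szX (szM _ _ _ _ (sz l1) (sz l3)))); try lia.
rewrite (pairing_pp _ _ (szM _ _ 1 _ szX (szM _ _ _ _ (sz l2) (sz l3)))); try lia.
rewrite (pairing_pp _ _ (szM _ _ 2 _ szX2
  (szM _ _ _ _ (szM _ _ _ _ (sz l1) (sz l2)) (sz l3)))) //; lia.
Qed.

Lemma arm_poly_monom p l : (forall k, (k < l)%N -> p k = 0) ->
  arm_poly p l = (-1) ^+ l *: 'X^l.
Proof.
elim: l => [|l IHl] p0 /=; first by rewrite scale1r.
rewrite IHl => [|k kl]; last by apply: p0; apply: leq_trans kl _.
rewrite pairing_monom p0 // mulr0 sub0r exprS mulN1r scaleNr.
by rewrite -scalerAr -exprS.
Qed.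

(** When p_1, ..., p_(m+1) vanish, m being the length of the longest arm, each
    [arm_poly] is a signed power of 'X and pairs to zero with the power sums, so all
    terms of the inclusion-exclusion containing an arm as a separate factor
    disappear and only the triple coincidence survives. *)
Lemma sun_of_powsum_top p l1 l2 l3 :
    (forall k, (k <= maxn l1 (maxn l2 l3))%N -> p k = 0) ->
  sun_of_powsum p l1 l2 l3 =
    (-1) ^+ (l1 + l2 + l3) * p (l1 + l2 + l3).+2 *+ 2.
Proof.
move=> p0; have armE l : (l <= maxn l1 (maxn l2 l3))%N ->
    arm_poly p l = (-1) ^+ l *: 'X^l.
  by move=> le_l; apply: arm_poly_monom => k kl; apply: p0; lia.
rewrite /sun_of_powsum !armE; try lia.
rewrite !pairing_monom !(p0 l1, p0 l2, p0 l3); try lia.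
rewrite !mulr0 !subr0 add0r -!(scalerAl, scalerAr) !scalerA -!exprD pairing_monom.
by rewrite [(l3 + l1)%N]addnC addnAC.
Qed.

End Universal.

Section Morphism.
Variables (R S : comNzRingType) (f : {rmorphism R -> S}).
Implicit Types p : nat -> R.

Lemma rmorph_pairing p q : f (pairing p q) = pairing (f \o p) (map_poly f q).
Proof.
rewrite [RHS](pairing_widen _ (size_poly _ _)) rmorph_sum.
by apply: eq_bigr => i _; rewrite rmorphM coef_map.
Qed.

Lemma rmorph_arm_poly p l : map_poly f (arm_poly p l) = arm_poly (f \o p) l.
Proof.
elim: l => [|l IHl] /=; first exact: rmorph1.
by rewrite rmorphB rmorphM /= map_polyC map_polyX IHl /= rmorph_pairing IHl.
Qed.

Lemma rmorph_sun_of_powsum p l1 l2 l3 :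
  f (sun_of_powsum p l1 l2 l3) = sun_of_powsum (f \o p) l1 l2 l3.
Proof.
rewrite /sun_of_powsum rmorphD !rmorphB rmorphMn !rmorphM !rmorph_pairing /=.
by rewrite !rmorphM /= map_polyX !rmorph_arm_poly.
Qed.

End Morphism.

Section ColourSums.
Variables (R : comNzRingType) (I : finType) (x : I -> R).
Let p k := \sum_i x i ^+ k.+1.

Lemma pairing_horner q : pairing p q = \sum_i x i * q.[x i].
Proof.
under [RHS]eq_bigr do rewrite horner_coef mulr_sumr.
rewrite exchange_big; apply: eq_bigr => k _ /=.
rewrite mulr_sumr; apply: eq_bigr => i _.
by rewrite mulrCA -exprS.
Qed.

(** Generating function of the proper colourings of a path with [l] vertices
    whose first vertex avoids the colour [c]. *)
Definition walks l c : R :=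
  \sum_(t : l.-tuple I | path (fun a b => a != b) c t) \prod_(i <- t) x i.

Lemma walks_arm_poly l c : walks l c = (arm_poly p l).[x c].
Proof.
elim: l c => [|l IHl] c /=.
  rewrite /walks (big_pred1 [tuple]) ?big_nil ?hornerC // => t.
  by rewrite tuple0; apply/esym/eqP.
have -> : walks l.+1 c = \sum_(d | d != c) x d * walks l d.
  rewrite /walks (reindex (fun u : I * l.-tuple I => cons_tuple u.1 u.2)) /=; last first.
    exists (fun t => (thead t, behead_tuple t)) => [[d t] _|t _] /=.
      by rewrite theadE; congr (_, _); apply: val_inj.
    exact: (esym (tuple_eta t)).
  under [RHS]eq_bigr do rewrite mulr_sumr.
  rewrite pair_big_dep; apply: eq_big => [[d t]|[d t] _] /=.
    by rewrite eq_sym.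
  by rewrite big_cons.
rewrite hornerD hornerC hornerN hornerM hornerX pairing_horner.
under eq_bigr do rewrite IHl.
rewrite [X in _ = X - _](bigD1 c) //=. by rewrite addrAC subrr add0r.
Qed.

(** Summing (1 - [i=j])(1 - [i=k])(1 - [j=k]) = 1 - [i=j] - [i=k] - [j=k] + 2[i=j=k]
    against a product of functions of i, j and k. *)
Lemma sum_triangle (f1 f2 f3 : I -> R) :
  \sum_i \sum_(j | i != j) \sum_(k | (i != k) && (j != k)) f1 i * f2 j * f3 k =
  (\sum_i f1 i) * (\sum_i f2 i) * (\sum_i f3 i)
  - (\sum_i f1 i * f2 i) * (\sum_i f3 i)
  - (\sum_i f1 i * f3 i) * (\sum_i f2 i)
  - (\sum_i f2 i * f3 i) * (\sum_i f1 i)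
  + (\sum_i f1 i * f2 i * f3 i) *+ 2.
Proof.
transitivity (\sum_i (\sum_(j | i != j) f1 i * f2 j *
    (\sum_k f3 k - f3 i - f3 j))).
  apply: eq_bigr => i _; apply: eq_bigr => j ij; rewrite -mulr_sumr.
  congr (_ * _); rewrite [in RHS](bigD1 i) //= [in RHS](bigD1 j) 1?eq_sym //=.
  rewrite (eq_bigl (fun k => (k != i) && (k != j))) => [|k]; last first.
    by rewrite ![k == _]eq_sym.
  ring.
set s3 := \sum_i f3 i.
transitivity (\sum_i f1 i * ((s3 - f3 i) * (\sum_j f2 j - f2 i)
   - (\sum_j f2 j * f3 j - f2 i * f3 i))).
  apply: eq_bigr => i _.
  have sum_ne F : \sum_(j | i != j) F j = \sum_j F j - F i :> R.
    rewrite [X in _ = X - _](bigD1 i) //= addrAC subrr add0r.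
    by apply: eq_bigl => j; rewrite eq_sym.
  rewrite -!sum_ne mulr_sumr -sumrB mulr_sumr; apply: eq_bigr => j _; ring.
set s2 := \sum_i f2 i; set s23 := \sum_i f2 i * f3 i.
transitivity (\sum_i (f1 i * (s3 * s2) - (f1 i * f2 i) * s3 - (f1 i * f3 i) * s2
  - f1 i * s23 + (f1 i * f2 i * f3 i) *+ 2)).
  by apply: eq_bigr => i _; ring.
rewrite big_split /= !sumrB -!mulr_suml sumrMnl; ring.
Qed.

Lemma sun_colour_sum l1 l2 l3 :
  \sum_i \sum_(j | i != j) \sum_(k | (i != k) && (j != k))
    (x i * walks l1 i) * (x j * walks l2 j) * (x k * walks l3 k) =
  sun_of_powsum p l1 l2 l3.
Proof.
rewrite sum_triangle /sun_of_powsum !pairing_horner.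
have walksE l : \sum_i x i * walks l i = \sum_i x i * (arm_poly p l).[x i].
  by apply: eq_bigr => i _; rewrite walks_arm_poly.
have walks2E l l' : \sum_i x i * walks l i * (x i * walks l' i) =
    \sum_i x i * ('X * (arm_poly p l * arm_poly p l')).[x i].
  by apply: eq_bigr => i _; rewrite !hornerM hornerX -!walks_arm_poly; ring.
rewrite !walksE !walks2E; congr (_ + _ *+ 2).
by apply: eq_bigr => i _; rewrite !hornerM hornerX -!walks_arm_poly; ring.
Qed.

End ColourSums.

(** * Colourings of the sun graph *)

Section Glue.
Variables (R : comNzRingType) (I : finType).

(** The colours along arm [i], listed from the vertex next to the triangle. *)
Definition arm_slice m (l : 'I_m -> nat) (k : {i : 'I_m & 'I_(l i)} -> I) i : (l i).-tuple I :=
  [tuple k (Tagged (fun i => 'I_(l i)) j) | j < l i].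

(** Colourings of a disjoint union of paths are independent on the paths, so
    weights that factor over the paths sum to a product. *)
Lemma sum_arm_slices m (l : 'I_m -> nat) (F : forall i, (l i).-tuple I -> R) :
  \sum_(k : {ffun {i : 'I_m & 'I_(l i)} -> I}) \prod_i F i (arm_slice k i) =
  \prod_i \sum_t F i t.
Proof.
pose F' i : {ffun (l i).-tuple I -> R} := [ffun t => F i t].
transitivity (\prod_i \sum_(t : (l i).-tuple I) F' i t); last first.
  by apply: eq_bigr => i _; apply: eq_bigr => t _; rewrite ffunE.
pose T i := (l i).-tuple I : finType.
under [RHS]eq_bigr => i _ do rewrite (@big_tag _ _ _ _ T (fun i => F' i) i).
rewrite bigA_distr_big_dep -(big_fprod 1 _ (T_ := T) F').
rewrite (reindex (fun u : fprod (fun i => (l i).-tuple I) =>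
  [ffun p : {i & 'I_(l i)} => tnth (u (tag p)) (tagged p)])) /=; last first.
  exists (fun k : {ffun {i : 'I_m & 'I_(l i)} -> I} => [fprod i => arm_slice k i]).
    move=> u _; apply/fprodP => i; rewrite fprodE.
    by apply: eq_from_tnth => j; rewrite tnth_mktuple ffunE.
  by move=> k _; apply/ffunP => [[i j]]; rewrite ffunE fprodE tnth_mktuple.
apply: eq_bigr => u _; apply: eq_bigr => i _; rewrite ffunE; congr F.
by apply: eq_from_tnth => j; rewrite tnth_mktuple ffunE.
Qed.

Lemma sum_glue (A B : finType) (F : {ffun A -> I} -> {ffun B -> I} -> R) :
  \sum_(k : {ffun A + B -> I}) F [ffun a => k (inl a)] [ffun b => k (inr b)] =
  \sum_c \sum_k F c k.
Proof.
rewrite pair_big /= (reindex (fun u : {ffun A -> I} * {ffun B -> I} =>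
  [ffun v : A + B => match v with inl a => u.1 a | inr b => u.2 b end])) /=; last first.
  exists (fun k => ([ffun a => k (inl a)], [ffun b => k (inr b)])).
    by move=> [c k] _ /=; congr (_, _); apply/ffunP=> v; rewrite !ffunE.
  by move=> k _; apply/ffunP=> [[a|b]]; rewrite !ffunE.
apply: eq_bigr => [[c k]] _ /=.
by congr F; apply/ffunP=> v; rewrite !ffunE.
Qed.

(** Properness of a colouring of the sun graph splits into a condition on the
    triangle and one condition on each arm with its attaching vertex. *)
Lemma proper_sun (l : 'I_3 -> nat) (k : {ffun 'I_3 + {i : 'I_3 & 'I_(l i)} -> I}) :
  [forall u, forall v, sun_edge u v ==> (k u != k v)] =
  [forall i : 'I_3, forall j : 'I_3, (i != j) ==> (k (inl i) != k (inl j))] &&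
  [forall i, path (fun a b => a != b) (k (inl i)) (arm_slice (fun p => k (inr p)) i)].
Proof.
have slice_nth i j x0 (jl : (j < l i)%N) :
    nth x0 (arm_slice (fun p => k (inr p)) i) j = k (inr (Tagged _ (Ordinal jl))).
  exact: (nth_mktuple _ x0 (Ordinal jl)).
apply/forallP/andP => [kP|[/forallP kT /forallP kA] u].
  have {}kP u v : sun_edge u v -> k u != k v.
    by have /forallP/(_ v)/implyP := kP u.
  split; apply/forallP => i; first by apply/forallP=> j; apply/implyP => ij; apply: kP.
  apply/(pathP (k (inl i))) => [[|j]]; rewrite size_tuple => jl.
    by rewrite /= slice_nth; apply: kP; rewrite /= !eqxx.
  by rewrite /= !slice_nth ?(ltnW jl) // => jl'; apply: kP; rewrite /= !eqxx.
apply/forallP => v; apply/implyP.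
have kArm i (j : 'I_(l i)) : k (inr (Tagged _ j)) =
    nth (k (inl i)) (arm_slice (fun p => k (inr p)) i) j.
  by rewrite slice_nth; congr (k (inr (Tagged _ _))); apply: val_inj.
have kA0 i (j : 'I_(l i)) : j = 0%N :> nat -> k (inl i) != k (inr (Tagged _ j)).
  move=> j0; have /(pathP (k (inl i)))/(_ 0%N) := kA i; rewrite size_tuple kArm j0.
  by apply; rewrite -j0.
have kAS i (j j' : 'I_(l i)) : j.+1 = j' :> nat ->
    k (inr (Tagged _ j)) != k (inr (Tagged _ j')).
  move=> jj'; have /(pathP (k (inl i)))/(_ j') := kA i; rewrite size_tuple !kArm.
  by rewrite -jj' /=; apply; rewrite jj'.
case: u v => [i|[i j]] [i'|[i' j']] /=.
- by have /forallP/(_ i')/implyP := kT i.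
- by case/andP=> /eqP <- /eqP/kA0.
- by case/andP=> /eqP <- /eqP/kA0; rewrite eq_sym.
case/andP=> /eqP ii'; case: _ / ii' j' => j' /orP[] /eqP /kAS //.
by rewrite eq_sym.
Qed.

Variable x : I -> R.

Lemma sum_injective_3 (F : nat -> I -> R) :
  \sum_(c : {ffun 'I_3 -> I} | [forall i, forall j, (i != j) ==> (c i != c j)])
     \prod_(i < 3) F i (c i) =
  \sum_i \sum_(j | i != j) \sum_(k | (i != k) && (j != k))
     F 0 i * F 1 j * F 2 k.
Proof.
rewrite pair_big_dep pair_big_dep /=.
rewrite (reindex (fun u : I * I * I =>
  [ffun a : 'I_3 => nth u.2 [:: u.1.1; u.1.2; u.2] a])) /=; last first.
  exists (fun c : {ffun 'I_3 -> I} => (c (inord 0), c (inord 1), c (inord 2))).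
    by move=> [[i j] k] _; rewrite !ffunE !inordK.
  move=> c _; apply/ffunP=> a; rewrite ffunE.
  by case: a => [[|[|[|]]] a3] //=; congr (c _); apply: val_inj; rewrite /= inordK.
apply: eq_big => [[[i j] k]|[[i j] k] _]; last first.
  by rewrite !big_ord_recl big_ord0 !ffunE /= mulr1 mulrA.
have forall3 (P : pred 'I_3) : [forall a, P a] =
    [&& P (@Ordinal 3 0 isT), P (@Ordinal 3 1 isT) & P (@Ordinal 3 2 isT)].
  apply/forallP/and3P=> [P3|[P0 P1 P2] [[|[|[|]]] a3]] //;
  by rewrite (bool_irrelevance a3 isT).
rewrite !forall3 !ffunE /=.
rewrite ![_ == i]eq_sym ![k == _]eq_sym.
by case: (i == j); case: (i == k); case: (j == k).
Qed.

Lemma sun_colour_sum_edges l1 l2 l3 :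
  \sum_(k : {ffun sun l1 l2 l3 -> I} |
      [forall u, forall v, edge u v ==> (k u != k v)]) \prod_v x (k v) =
  sun_of_powsum (fun k => \sum_i x i ^+ k.+1) l1 l2 l3.
Proof.
rewrite -sun_colour_sum /=; set l : 'I_3 -> nat := fun i => _.
pose good (c : {ffun 'I_3 -> I}) := [forall i, forall j, (i != j) ==> (c i != c j)].
pose arms (c : {ffun 'I_3 -> I}) i (t : (l i).-tuple I) :=
  path (fun a b => a != b) (c i) t.
transitivity (\sum_(c | good c) \prod_i (x (c i) * walks x (l i) (c i))).
  pose F (c : {ffun 'I_3 -> I}) i (t : (l i).-tuple I) : R :=
     if arms c i t then x (c i) * \prod_(a <- t) x a else 0.
  transitivity (\sum_(c | good c) \prod_i (\sum_t F c i t)); last first.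
    apply: eq_bigr => c _; apply: eq_bigr => i _.
    by rewrite /walks mulr_sumr -big_mkcond.
  under [RHS]eq_bigr do rewrite -sum_arm_slices.
  rewrite [RHS]big_mkcond /=.
  pose G (c : {ffun 'I_3 -> I}) (k : {ffun {i & 'I_(l i)} -> I}) :=
    if good c then \prod_i F c i (arm_slice k i) else 0.
  transitivity (\sum_c \sum_k G c k); last first.
    by apply: eq_bigr => c _; rewrite /G; case: ifP => // _; rewrite big1.
  rewrite -sum_glue big_mkcond; apply: eq_bigr => k _ /=.
  rewrite proper_sun /G.
  have -> : good [ffun a => k (inl a)] =
      [forall i, forall j, (i != j) ==> (k (inl i) != k (inl j))].
    by apply: eq_forallb => i; apply: eq_forallb => j; rewrite !ffunE.
  case: [forall i, forall j, _] => //=.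
  have sliceE i : arm_slice [ffun b => k (inr b)] i = arm_slice (fun p => k (inr p)) i.
    by apply: eq_from_tnth => j; rewrite !tnth_mktuple ffunE.
  under [RHS]eq_bigr => i _ do rewrite /F /arms sliceE ffunE.
  case: forallP => [kA|/forallP]; last first.
    by rewrite negb_forall => /existsP[i /negbTE kA]; rewrite (bigD1 i) //= kA mul0r.
  under [RHS]eq_bigr => i _ do rewrite kA.
  rewrite big_split big_sumType /=; congr (_ * _).
  under [RHS]eq_bigr => i _ do rewrite big_map big_enum.
  rewrite sig_big_dep; apply: eq_bigr => [[i j]] _ //=.
exact: (sum_injective_3 (fun i a => x a * walks x (nth 0%N [:: l1; l2; l3] i) a)).
Qed.

End Glue.

(** * Isolating two-part elementary products *)

Lemma polyC_sign (S : comNzRingType) m : (-1) ^+ m = ((-1) ^+ m)%:P :> {poly S}.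
Proof. by rewrite rmorphXn rmorphN1. Qed.

Section Graded.
Variables (S : comNzRingType) (d : nat -> S).

(** Values for the e_i in which 'X counts the number of factors e_i with i > 0. *)
Definition graded i : {poly S} := if i is 0%N then 1 else d i *: 'X.

Lemma powsum_graded0 k : (forall i, (0 < i <= k.+1)%N -> d i = 0) ->
  powsum graded k = 0.
Proof.
move=> d0; rewrite powsumE /powsum_step /= d0 ?leqnn // scale0r mul0rn.
rewrite big1 ?subr0 ?mulr0 // => i _.
rewrite -(subnSK (ltn_ord i)) /= d0 ?scale0r ?mulr0 ?mul0r //.
by have := ltn_ord i; lia.
Qed.

Let coef_step k j : (powsum graded k)`_j =
  (-1) ^+ k * ((d k.+1 *: 'X)`_j *+ k.+1
    - \sum_(i < k) (-1) ^+ i * d (k - i)%N * ('X * powsum graded i)`_j).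
Proof.
rewrite powsumE /powsum_step polyC_sign coefCM coefB coefMn coef_sum.
congr (_ * (_ - _)); apply: eq_bigr => i _.
rewrite -[in LHS](subnSK (ltn_ord i)) /= (subnSK (ltn_ord i)).
by rewrite polyC_sign -mulrA -scalerAl coefCM coefZ mulrA.
Qed.

Lemma coef0_powsum_graded k : (powsum graded k)`_0 = 0.
Proof.
rewrite coef_step coefZ coefX mulr0 mul0rn big1 ?subr0 ?mulr0 // => i _.
by rewrite coefXM mulr0.
Qed.

Lemma coef1_powsum_graded k :
  (powsum graded k)`_1 = (-1) ^+ k * (d k.+1 *+ k.+1).
Proof.
rewrite coef_step coefZ coefX mulr1 big1 ?subr0 // => i _.
by rewrite coefXM /= coef0_powsum_graded mulr0.
Qed.

(** Only linear terms of the lower power sums contribute to the quadratic term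
    of p_(k+1); Newton's identity then gives it as a convolution. *)
Lemma coef2_powsum_graded k :
  (powsum graded k)`_2 =
  - ((-1) ^+ k * \sum_(i < k) d (k - i)%N * d i.+1 *+ i.+1).
Proof.
rewrite coef_step coefZ coefX mulr0 mul0rn sub0r mulrN.
congr (- (_ * _)); apply: eq_bigr => i _.
rewrite coefXM /= coef1_powsum_graded mulrACA -expr2 sqrr_sign mul1r.
by rewrite mulrnAr.
Qed.

Lemma coef_prod_graded la j : 0%N \notin la ->
  (\prod_(i <- la) graded i)`_j = (\prod_(i <- la) d i) *+ (j == size la).
Proof.
move=> la0; rewrite (_ : \prod_(i <- la) _ = (\prod_(i <- la) d i) *: 'X^(size la)).
  by rewrite coefZ coefXn mulr_natr.
elim: la la0 => [|i la IHla]; first by rewrite !big_nil scale1r.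
rewrite inE negb_or eq_sym -lt0n => /andP[i0 la0].
rewrite !big_cons IHla // -(prednK i0) /=.
by rewrite -scalerAl -scalerAr scalerA -exprS.
Qed.

End Graded.

(** Combined with [graded], this kills every e_i except e_a and e_b and counts the
    factors e_b with a second variable, so that e_a e_b is detected by one
    coefficient.  The encoding also covers a = b, where e_a e_a is counted
    twice. *)
Definition two_part (a b i : nat) : {poly rat} :=
  (i == a)%:R%:P + (i == b)%:R *: 'X.

Lemma coef1_two_part_mul a b i j :
  (two_part a b i * two_part a b j)`_1 =
  ((i == a) && (j == b))%:R + ((i == b) && (j == a))%:R.
Proof.
have coef0 m : (two_part a b m)`_0 = (m == a)%:R.
  by rewrite coefD coefC coefZ coefX mulr0 addr0.
have coef1 m : (two_part a b m)`_1 = (m == b)%:R.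
  by rewrite coefD coefC coefZ coefX mulr1 add0r.
rewrite coefM !big_ord_recr big_ord0 /= add0r !coef0 !coef1.
by rewrite -!natrM !mulnb.
Qed.

Lemma coef_two_part_prod a b la :
    (0 < a)%N -> (b <= a)%N -> is_partition la ->
  ((\prod_(i <- la) graded (two_part a b) i)`_2)`_1 =
  (1 + (a == b)%:R) *+ (la == [:: a; b]).
Proof.
move=> a0 ba /andP[].
have [->|la2] := eqVneq la [:: a; b].
  move=> _ /andP[_ /andP[b0 _]]; rewrite coef_prod_graded; last first.
    by rewrite !inE negb_or ![0%N == _]eq_sym -!lt0n a0 b0.
  rewrite !big_cons big_nil mulr1 coef1_two_part_mul !eqxx /= mulr1n.
  by rewrite [b == a]eq_sym andbb.
move=> la_sorted la_pos.
rewrite coef_prod_graded; last by apply/negP=> /(allP la_pos).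
case: la la2 la_sorted {la_pos} => [|i [|j [|k la]]] //=; rewrite ?mulr0n ?coef0 //.
move=> la2 /andP[ji _]; rewrite mulr1n !big_cons big_nil mulr1 coef1_two_part_mul.
move: la2; rewrite !eqseq_cons eqxx andbT => /negbTE la2; rewrite la2 add0r.
case: eqP => // ib; case: eqP => // ja; move: la2 ji; rewrite ib ja /= => ab le_ab.
by case/negP: ab; rewrite eq_sym andbb eqn_leq ba andbT.
Qed.

Lemma coef_powsum_two_part a b : (0 < a)%N -> (0 < b)%N ->
  ((powsum (graded (two_part a b)) (a + b).-1)`_2)`_1 =
  (-1) ^+ (a + b) * (a + b)%:R.
Proof.
move=> a0 b0; rewrite coef2_powsum_graded.
have -> : (-1) ^+ (a + b).-1 = - (-1) ^+ (a + b) :> {poly rat}.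
  have [m ->] : exists m, (a + b = m.+1)%N by exists (a + b).-1; lia.
  by rewrite exprS mulN1r opprK.
rewrite mulNr opprK polyC_sign coefCM; congr (_ * _).
rewrite coef_sum.
under eq_bigr do rewrite coefMn coef1_two_part_mul mulrnDl.
rewrite big_split natrD addrC; congr (_ + _) => /=.
  have ltb : (b.-1 < (a + b).-1)%N by lia.
  rewrite (bigD1 (Ordinal ltb)) //= prednK // eqxx andbT.
  have -> : ((a + b).-1 - b.-1 == a)%N by lia.
  rewrite big1 ?addr0 // => i; rewrite -val_eqE /= => ib.
  by rewrite (_ : (i.+1 == b) = false) ?andbF ?mul0rn //; lia.
have lta : (a.-1 < (a + b).-1)%N by lia.
rewrite (bigD1 (Ordinal lta)) //= prednK // eqxx andbT.
have -> : ((a + b).-1 - a.-1 == b)%N by lia.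
rewrite big1 ?addr0 // => i; rewrite -val_eqE /= => ia.
by rewrite (_ : (i.+1 == a) = false) ?andbF ?mul0rn //; lia.
Qed.

Lemma coef_sun_of_powsum l1 l2 l3 a b :
    ((maxn l1 (maxn l2 l3)).+1 < b)%N -> (b <= a)%N ->
    (a + b = l1 + l2 + l3 + 3)%N ->
  ((sun_of_powsum (powsum (graded (two_part a b))) l1 l2 l3)`_2)`_1 =
  - (2 * (a + b)%N%:R).
Proof.
move=> lb ba abn; rewrite sun_of_powsum_top => [|k kl]; last first.
  apply: powsum_graded0 => i ik; rewrite /two_part.
  have [-> ->] : (i == a) = false /\ (i == b) = false by lia.
  by rewrite scale0r addr0.
have -> : (l1 + l2 + l3).+2 = (a + b).-1 by lia.
rewrite coefMn polyC_sign coefCM coefMn polyC_sign coefCM coef_powsum_two_part; try lia.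
rewrite mulrA -exprD -signr_odd (_ : odd _ = true) ?expr1; last by lia.
by rewrite mulN1r mulNrn mulr_natl.
Qed.

(** * Restricting power series to finitely many variables *)

(** All sums in the definitions of the power series run over infinite sets, but
    on each monomial their support is the image of a finite type. *)
Lemma fsbig_finType (R : nmodType) (T : choiceType) (J : finType)
    (P : set T) (Q : pred J) (h : J -> T) (F : T -> R) :
    injective h -> (forall j, Q j -> P (h j)) ->
    (forall t, P t -> F t != 0 -> exists2 j, Q j & t = h j) ->
  \sum_(t \in P) F t = \sum_(j | Q j) F (h j).
Proof.
move=> h_inj QP suppF.
rewrite (@fsbigE _ _ _ _ _ [seq h j | j <- index_enum J & Q j]); first last.
- move=> t Pt; apply: contraNeq => /(suppF t Pt)[j Qj ->].
  by rewrite map_f // mem_filter Qj mem_index_enum.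
- by move=> _ /mapP[j + ->]; rewrite mem_filter => /andP[/QP].
- by rewrite map_inj_uniq // filter_uniq // index_enum_uniq.
rewrite big_map big_filter_cond /=; apply: eq_bigl => j.
by case: (boolP (Q j)) => //= /QP ?; apply/mem_set.
Qed.

Section Restriction.
Variable N : nat.
Local Notation poly := {mpoly rat[N]}.

Definition mnm_of (M : {mset nat}%mset) : 'X_{1..N} := [multinom M (i : nat) | i < N].

(** Exponent vectors in [N] variables and multisets supported below [N] are the
    same monomials; [mset_of] and [mnm_of] are mutually inverse. *)
Definition mset_of (m : 'X_{1..N}) : {mset nat}%mset :=
  [fsfun x in seq_fset tt (iota 0 N) => nth 0%N (multinom_val m) x].

Lemma mset_ofE (m : 'X_{1..N}) (i : 'I_N) : mset_of m i = m i.
Proof. by rewrite fsfunE seq_fsetE mem_iota /= ltn_ord [RHS](tnth_nth 0%N). Qed.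

Definition below (M : {mset nat}%mset) : Prop := forall i, (N <= i)%N -> M i = 0%N.

Lemma below_mset_of m : below (mset_of m).
Proof. by move=> i Ni; rewrite fsfunE seq_fsetE mem_iota /= ltnNge Ni. Qed.

Lemma mset_ofK m : mnm_of (mset_of m) = m.
Proof. by apply/mnmP => i; rewrite mnmE mset_ofE. Qed.

Lemma mnm_ofK M : below M -> mset_of (mnm_of M) = M.
Proof.
move=> MN; apply/msetP => i; have [iN|Ni] := ltnP i N.
  by rewrite (mset_ofE _ (Ordinal iN)) mnmE.
by rewrite below_mset_of ?MN.
Qed.

Lemma eq_mnm_of M M' : below M -> below M' -> (mnm_of M == mnm_of M') = (M == M').
Proof.
move=> MN MN'; apply/eqP/eqP => [e|-> //].
by rewrite -(mnm_ofK MN) e mnm_ofK.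
Qed.

Lemma eq_mset_of M (m : 'X_{1..N}) :
  below M -> (forall i : 'I_N, M i = m i) -> M = mset_of m.
Proof.
move=> MN Mm; rewrite -(mnm_ofK MN); congr mset_of.
by apply/mnmP => i; rewrite mnmE.
Qed.

Lemma mnm_ofD (M M' : {mset nat}%mset) : mnm_of (M `+` M')%mset = (mnm_of M + mnm_of M')%MM.
Proof. by apply/mnmP=> i; rewrite !(mnmDE, mnmE) msetE2. Qed.

(** [P] is what remains of the power series [f] when the variables of index at
    least [N] are set to zero. *)
Definition restricts (f : powser) (P : poly) :=
  forall M, below M -> f M = P@_(mnm_of M).

Lemma restricts_one : restricts psone 1.
Proof.
move=> M MN; rewrite /psone mcoeff1; congr (_%:R).
have below0 : below mset0 by move=> i _; rewrite mset0E.
rewrite -(eq_mnm_of MN below0); congr (nat_of_bool (_ == _)).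
by apply/mnmP=> i; rewrite mnmE mnm0E mset0E.
Qed.

(** A sum of multisets is supported below [N] only if both summands are, so the
    convolution does not leave the first [N] variables. *)
Lemma restricts_mul f g P Q :
  restricts f P -> restricts g Q -> restricts (psmul f g) (P * Q).
Proof.
move=> fP gQ M MN; rewrite mcoeffM /psmul.
pose d := (mdeg (mnm_of M)).+1.
rewrite (fsbig_finType
  (Q := fun k : 'X_{1..N < d, d} => mnm_of M == (k.1 + k.2)%MM)
  (h := fun k => (mset_of k.1, mset_of k.2))).
- apply: eq_bigr => k _ /=.
  by rewrite fP ?gQ ?mset_ofK //; apply: below_mset_of.
- move=> [k1 k2] [k3 k4] [/(congr1 mnm_of) e1 /(congr1 mnm_of) e2].
  by move: e1 e2; rewrite !mset_ofK => /val_inj-> /val_inj->.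
- move=> k /eqP MK /=; apply/eqP; rewrite -eq_mnm_of //.
    by rewrite mnm_ofD !mset_ofK MK.
  by move=> i Ni; rewrite msetE2 !below_mset_of.
move=> [M1 M2] /= M12 _.
have [M1N M2N] : below M1 /\ below M2.
  by split=> i /MN; rewrite -M12 msetE2 => /eqP; rewrite addn_eq0 => /andP[/eqP + /eqP].
have lt1 : (mdeg (mnm_of M1) < d)%N.
  by rewrite /d -M12 mnm_ofD mdegD ltnS leq_addr.
have lt2 : (mdeg (mnm_of M2) < d)%N.
  by rewrite /d -M12 mnm_ofD mdegD ltnS leq_addl.
exists (BMultinom lt1, BMultinom lt2) => /=; first by rewrite -mnm_ofD M12.
by rewrite !mnm_ofK.
Qed.

(** Elementary and chromatic symmetric functions are both sums of monomials
    indexed by combinatorial objects on nat (sets, colourings); those whose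
    monomial is supported below [N] live on 'I_N. *)
Lemma restricts_sum_monom (T : choiceType) (J : finType) (P : set T) (Q : pred J)
    (h : J -> T) (mon : T -> {mset nat}%mset) (mon' : J -> 'X_{1..N}) :
    injective h -> (forall j, Q j -> P (h j)) ->
    (forall t, P t -> below (mon t) -> exists2 j, Q j & t = h j) ->
    (forall j, mon (h j) = mset_of (mon' j)) ->
  restricts (fun M => \sum_(t \in P) ((M == mon t)%:R : rat)) (\sum_(j | Q j) 'X_[mon' j]).
Proof.
move=> h_inj QP surj monE M MN.
rewrite (fsbig_finType h_inj QP) => [|t Pt]; last first.
  by have [Mt _|//] := eqVneq M (mon t); apply: surj => //; rewrite -Mt.
rewrite raddf_sum; apply: eq_bigr => j _ /=.
by rewrite mcoeffX monE -(eq_mnm_of MN (@below_mset_of _)) mset_ofK eq_sym.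
Qed.

Lemma restricts_elementary k : restricts (elementary k) (mesym N rat k).
Proof.
rewrite mesymE; apply: (restricts_sum_monom
  (h := fun B : {set 'I_N} => [fset val i | i in B]%fset)) => [B B' eqB|B|A|B].
- apply/setP=> i; have := congr1 (fun A : {fset nat} => val i \in A) eqB.
  by rewrite /= !(mem_imfset _ _ val_inj).
- by move=> /= /eqP <-; rewrite card_imfset /= ?cardE //; apply: val_inj.
- move=> /= Ak AN; have lt_A i : i \in A -> (i < N)%N.
    by apply: contraTltn => /AN/eqP; rewrite mset_seqE => /eqP/count_memPn.
  have AE : A = [fset val i | i in [set i : 'I_N | val i \in A]]%fset.
    apply/fsetP=> i; apply/idP/imfsetP => [iA|[j + ->]]; last by rewrite inE.
    by exists (Ordinal (lt_A i iA)); rewrite ?inE.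
  exists [set i : 'I_N | val i \in A] => //.
  by apply/eqP; rewrite -Ak [in RHS]AE card_imfset /= ?cardE //; apply: val_inj.
- apply: eq_mset_of => i.
    move=> Ni; rewrite mset_seqE; apply/count_memPn; apply/imfsetP=> [[j _ ij]].
    by move: Ni; rewrite ij leqNgt ltn_ord.
  by rewrite mset_seqE count_uniq_mem ?fset_uniq // (mem_imfset _ _ val_inj) mnmE.
Qed.

Definition colour_sum (G : sgraph) : poly :=
  \sum_(k : {ffun G -> 'I_N} | [forall u, forall v, edge u v ==> (k u != k v)])
    \prod_v 'X_(k v).

Lemma restricts_chromatic_sf (G : sgraph) : restricts (chromatic_sf G) (colour_sum G).
Proof.
rewrite /colour_sum; under eq_bigr do rewrite mprodXE.
apply: (restricts_sum_monom
  (h := fun k : {ffun G -> 'I_N} => [ffun v => val (k v)])) => [k k' eqk|k|k|k].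
- apply/ffunP=> v; have := congr1 (fun k : {ffun G -> nat} => k v) eqk.
  by rewrite !ffunE => /val_inj.
- move=> /forallP kP u v uv; rewrite !ffunE.
  by have /forallP/(_ v)/implyP := kP u; apply.
- move=> kP kN.
  have kvN v : (k v < N)%N.
    rewrite ltnNge; apply/negP=> /kN; rewrite mset_seqE => /count_memPn/negP.
    by apply; apply: codom_f.
  exists [ffun v => Ordinal (kvN v)]; last by apply/ffunP=> v; rewrite !ffunE.
  apply/forallP=> u; apply/forallP=> v; apply/implyP=> uv.
  by rewrite !ffunE -val_eqE /=; apply: kP.
- apply: eq_mset_of => i.
    move=> Ni; rewrite mset_seqE; apply/count_memPn; apply/codomP=> [[v iv]].
    by move: Ni; rewrite iv ffunE leqNgt ltn_ord.
  rewrite mset_seqE mnm_sumE /codom /image_mem count_map -sum1_count.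
  rewrite big_enum_cond big_mkcond /=; apply: eq_bigr => v _.
  by rewrite ffunE mnmE -val_eqE /=; case: eqP.
Qed.

End Restriction.

(** * Elementary expansions *)

Lemma restricts_elementary_prod N la :
  restricts (elementary_prod la) (\prod_(i <- la) mesym N rat i).
Proof.
elim: la => [|i la IHla]; first by rewrite big_nil; apply: restricts_one.
by rewrite big_cons; apply: restricts_mul => //; apply: restricts_elementary.
Qed.

Lemma restricts_inj N f (P Q : {mpoly rat[N]}) :
  restricts f P -> restricts f Q -> P = Q.
Proof.
move=> fP fQ; apply/mpolyP => m; rewrite -(mset_ofK m).
by rewrite -fP ?fQ //; apply: below_mset_of.
Qed.

Lemma below_exists (M : {mset nat}%mset) : exists N, below N M.
Proof.
exists (\max_(i <- finsupp M) i).+1 => i; apply: contraTeq => Mi.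
rewrite -ltnNge ltnS; apply: (@leq_bigmax_seq _ _ _ (fun i => i)) => //.
by rewrite mem_finsupp.
Qed.

Lemma colour_sum_sun N l1 l2 l3 :
  colour_sum N (sun l1 l2 l3) = sun_of_powsum (powsum (mesym N rat)) l1 l2 l3.
Proof.
rewrite /colour_sum (sun_colour_sum_edges (fun i => 'X_i : {mpoly rat[N]})).
apply: eq_sun_of_powsum.
by apply: powsum_unique => k _; apply: esum_powsum.
Qed.

Section Universal.
Variable n : nat.

(** The polynomial ring in formal variables for e_1, ..., e_n; variable number
    [j] stands for e_(j+1), e_0 is 1 and higher e_i are 0. *)
Definition e_var i : {mpoly rat[n]} :=
  if i is j.+1 then oapp (fun j' : 'I_n => 'X_j') 0 (insub j) else 1.

Definition mesyms N : n.-tuple {mpoly rat[N]} := [tuple mesym N rat i.+1 | i < n].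

Lemma e_varS (j : 'I_n) : e_var j.+1 = 'X_j.
Proof. by rewrite /= valK. Qed.

Lemma e_var_gt i : (n < i)%N -> e_var i = 0.
Proof. by case: i => // j nj; rewrite /e_var insubF //; lia. Qed.

Lemma e_var_mesym N i : (i <= n)%N || (N <= n)%N -> e_var i \mPo mesyms N = mesym N rat i.
Proof.
case: i => [_|j]; first by rewrite comp_mpoly1 mesym0E.
have [jn _|nj Nn] := ltnP j n.
  by rewrite (e_varS (Ordinal jn)) comp_mpolyXU -tnth_nth tnth_mktuple.
by rewrite e_var_gt // comp_mpoly0 mesym_geqnE //; lia.
Qed.

Definition sun_epoly l1 l2 l3 := sun_of_powsum (powsum e_var) l1 l2 l3.

(** One polynomial works for all numbers [N] of variables, even when [N > n]: it
    only involves power sums up to p_n, hence only e_1, ..., e_n. *)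
Lemma sun_epoly_mesym N l1 l2 l3 : (l1 + l2 + l3 + 3 <= n)%N ->
  sun_epoly l1 l2 l3 \mPo mesyms N = colour_sum N (sun l1 l2 l3).
Proof.
move=> ln; rewrite /sun_epoly rmorph_sun_of_powsum colour_sum_sun.
apply: eq_sun_of_powsum => k kl; rewrite /= rmorph_powsum.
by apply: (@eq_powsum _ _ _ n) => [i /andP[_ le_in]|]; rewrite /= ?e_var_mesym ?le_in //; lia.
Qed.

(** The partition whose number of parts equal to i + 1 is the exponent of
    variable [i]. *)
Definition part_of (m : 'X_{1..n}) : seq nat :=
  sort geq (flatten [seq nseq (m i) i.+1 | i <- enum 'I_n]).

Definition mnm_of_part (la : seq nat) : 'X_{1..n} :=
  [multinom count_mem i.+1 la | i < n].

Lemma part_ofK : cancel part_of mnm_of_part.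
Proof.
move=> m; apply/mnmP=> i; rewrite mnmE count_sort count_flatten -map_comp.
rewrite sumnE big_map big_enum (bigD1 i) //= count_nseq /= eqxx mul1n big1 ?addn0 //.
by move=> j ji; rewrite count_nseq /= eqSS val_eqE (negbTE ji).
Qed.

Lemma part_of_partition m : is_partition (part_of m).
Proof.
apply/andP; split; first by apply: sort_sorted => i j; apply: leq_total.
by rewrite all_sort; apply/allP => i /flatten_mapP[j _]; rewrite mem_nseq => /andP[_ /eqP->].
Qed.

Lemma comp_mesym_monom N m :
  'X_[m] \mPo mesyms N = \prod_(i <- part_of m) mesym N rat i.
Proof.
rewrite comp_mpolyX (perm_big _ (permEl (perm_sort _ _))) big_flatten big_map big_enum.
by apply: eq_bigr => i _; rewrite tnth_mktuple big_nseq -Monoid.iteropE.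
Qed.

(** Each monomial of a power series involves finitely many variables, so an
    expansion valid after restriction to any number of variables is valid. *)
Lemma e_expansion_exists X (Q : {mpoly rat[n]}) :
    (forall N, restricts X (Q \mPo mesyms N)) ->
  exists c, e_expansion X c.
Proof.
move=> XQ; pose s := [seq part_of m | m <- msupp Q].
pose c : {fsfun seq nat -> rat with 0} :=
  [fsfun la in seq_fset tt s => Q@_(mnm_of_part la)].
have mem_c la : (la \in finsupp c) = (la \in s).
  rewrite mem_finsupp fsfunE seq_fsetE.
  case: (boolP (la \in s)); rewrite ?eqxx // => /mapP[m mQ ->].
  by rewrite part_ofK -mcoeff_msupp.
exists c; split=> [la|M]; first by rewrite mem_c => /mapP[m _ ->]; apply: part_of_partition.
have perm_c : perm_eq (finsupp c) s.
  apply: uniq_perm (fset_uniq _) _ mem_c.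
  by rewrite map_inj_uniq ?msupp_uniq //; apply: can_inj part_ofK.
rewrite (perm_big _ perm_c) /s big_map.
have [N MN] := below_exists M.
rewrite (XQ N) // comp_mpolyEX raddf_sum big_seq [RHS]big_seq /=.
apply: eq_bigr => m mQ; rewrite fsfunE seq_fsetE map_f // part_ofK.
by rewrite mcoeffZ comp_mesym_monom (restricts_elementary_prod _ MN).
Qed.

(** The fundamental theorem of symmetric polynomials in [n] variables: the
    elementary polynomials e_1, ..., e_n are algebraically independent. *)
Lemma e_expansion_unique X (Q : {mpoly rat[n]}) c :
    restricts X (Q \mPo mesyms n) -> e_expansion X c ->
  Q = \sum_(la <- finsupp c) c la *: \prod_(i <- la) e_var i.
Proof.
move=> XQ [_ Xc]; apply: msym_fundamental_un; apply: (restricts_inj XQ) => M MN.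
rewrite Xc (raddf_sum (comp_mpoly (mesyms n))) raddf_sum; apply: eq_bigr => la _ /=.
rewrite comp_mpolyZ mcoeffZ rmorph_prod (restricts_elementary_prod _ MN) /=.
by congr (_ * (_)@__); apply: eq_bigr => i _; rewrite e_var_mesym ?leqnn ?orbT.
Qed.

End Universal.

(** Specialising the e_i by [two_part] turns any expansion into one in which a
    single coefficient isolates e_a e_b, with multiplicity two if a = b.  The
    hypothesis on [b] makes the power sums up to the longest arm vanish, because
    all e_i with 0 < i < b do. *)
Lemma e_expansion_two_part l1 l2 l3 a b c :
    ((maxn l1 (maxn l2 l3)).+1 < b)%N -> (b <= a)%N ->
    (a + b = l1 + l2 + l3 + 3)%N ->
    e_expansion (chromatic_sf (sun l1 l2 l3)) c ->
  c [:: a; b] * (1 + (a == b)%:R) = - (2 * (a + b)%N%:R).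
Proof.
move=> lb ba abn Xc; rewrite -(coef_sun_of_powsum lb ba abn).
pose n := (a + b)%N; have a0 : (0 < a)%N by lia.
pose eps := graded (two_part a b).
pose phi := mmap (polyC \o (polyC : rat -> {poly rat})) (fun i : 'I_n => eps i.+1).
have phi_e_var i : phi (e_var n i) = eps i.
  case: i => [|j]; first by rewrite /phi rmorph1.
  have [jn|nj] := ltnP j n.
    by rewrite (e_varS (Ordinal jn)) /phi mmapX mmap1U.
  rewrite e_var_gt // /phi mmap0 /eps /= /two_part.
  have [-> ->] : (j.+1 == a) = false /\ (j.+1 == b) = false by lia.
  by rewrite !scale0r addr0 scale0r.
have <- : phi (sun_epoly n l1 l2 l3) = sun_of_powsum (powsum eps) l1 l2 l3.
  rewrite /sun_epoly /phi rmorph_sun_of_powsum; apply: eq_sun_of_powsum => k _ /=.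
  rewrite rmorph_powsum; apply: (@eq_powsum _ _ _ k.+1) => // i _.
  exact: phi_e_var.
have XQ : restricts (chromatic_sf (sun l1 l2 l3)) (sun_epoly n l1 l2 l3 \mPo mesyms n n).
  by rewrite sun_epoly_mesym ?/n ?abn //; apply: restricts_chromatic_sf.
rewrite (e_expansion_unique XQ Xc) /phi rmorph_sum !coef_sum /=.
have [c_part _] := Xc.
transitivity (\sum_(la <- finsupp c) c la * ((1 + (a == b)%:R) *+ (la == [:: a; b]))).
  have [mu_c|mu_c] := boolP ([:: a; b] \in finsupp c).
    rewrite (bigD1_seq [:: a; b]) ?fset_uniq //= eqxx mulr1n big1 ?addr0 //.
    by move=> la /negbTE ->; rewrite mulr0n mulr0.
  rewrite fsfun_dflt // mul0r big_seq big1 // => la la_c.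
  by rewrite (_ : (la == _) = false) ?mulr0n ?mulr0 //; apply: contraNF mu_c => /eqP <-.
rewrite big_seq [RHS]big_seq; apply: eq_bigr => la la_c.
rewrite mmapZ /= !coefCM; congr (_ * _).
have phi_prod : phi (\prod_(i <- la) e_var n i) = \prod_(i <- la) eps i.
  by rewrite /phi rmorph_prod; apply: eq_bigr => i _; apply: phi_e_var.
by rewrite -coef_two_part_prod ?c_part // -phi_prod.
Qed.

Theorem lemma3p15 (l1 l2 l3 : nat)
    (hl1 : (0 < l1)%N) (hl2 : (0 < l2)%N) (hl3 : (0 < l3)%N)
    (hmax : l1 = maxn l1 (maxn l2 l3)) (hlt : (l1 < l2 + l3)%N) :
  ((l2 + l3)%N <> (l1 + 1)%N ->
     e_coef [:: (l2 + l3 + 1)%N; (l1 + 2)%N] (chromatic_sf (sun l1 l2 l3))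
     = - (2 * (l1 + l2 + l3 + 3)%N%:R)) /\
  ((l2 + l3)%N = (l1 + 1)%N ->
     e_coef [:: (l2 + l3 + 1)%N; (l1 + 2)%N] (chromatic_sf (sun l1 l2 l3))
     = - (l1 + l2 + l3 + 3)%N%:R).
Proof.
have expand : e_expansion (chromatic_sf (sun l1 l2 l3))
    (xget [fsfun] [set c | e_expansion (chromatic_sf (sun l1 l2 l3)) c]%classic).
  apply: xgetPex; apply: (@e_expansion_exists _ _ (sun_epoly (l1 + l2 + l3 + 3) l1 l2 l3)).
  by move=> N; rewrite sun_epoly_mesym //; apply: restricts_chromatic_sf.
have abn : (l2 + l3 + 1 + (l1 + 2) = l1 + l2 + l3 + 3)%N by lia.
have := e_expansion_two_part _ _ abn expand; rewrite -/(e_coef _ _) abn -hmax.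
move=> /(_ _ _)-/(_ ltac:(lia) ltac:(lia)) coefE.
split=> l23.
  have ne_ab : (l2 + l3 + 1 == l1 + 2)%N = false by lia.
  by move: coefE; rewrite ne_ab addr0 mulr1.
(* Here both factors coincide, so the coefficient is counted twice. *)
have eq_ab : (l2 + l3 + 1 == l1 + 2)%N by lia.
by move: coefE; rewrite eq_ab mulrC -mulrN => /mulfI; apply.
Qed.
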